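(* Let $k\ge 2$ and let $T$ be a $k$-tree of order $n\ge k+1$. If $n\neq k+2$ and a $k$-clique $C$ of $T$ maximizes $\mu(T;C)$ over all $k$-cliques of $T$, then $C$ has degree $1$. If $n=k+2$, then every $k$-clique $C$ of $T$ satisfies $\mu(T;C)=k+1$.
   Context: A $k$-tree is defined recursively: $K_k$ is a $k$-tree, and if $T$ is a $k$-tree then so is the graph obtained by joining a new vertex to all vertices of some $k$-clique of $T$; there are no others. A sub-$k$-tree of $T$ is a subgraph that is itself a $k$-tree. For a $k$-clique $C$ of $T$, $N(T;C)$ is the number of sub-$k$-trees of $T$ containing $C$, $R(T;C)$ is the sum of their numbers of vertices, and $\mu(T;C)=R(T;C)/N(T;C)$ is the local mean sub-$k$-tree order. The degree of a $k$-clique is the number of $(k+1)$-cliques containing it. *)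

(* Defs.v *)
From HB Require Import structures.
From mathcomp Require Import all_boot all_order all_algebra.
From mathcomp Require Import boolp.
Set Implicit Arguments. Unset Strict Implicit. Unset Printing Implicit Defensive.
Import Order.TTheory GRing.Theory Num.Theory.

(* Graphs on a finite type V: a vertex set S : {set V} and an edge set
   E : {set {set V}} (each edge a 2-element set). *)

Definition isclique (V : finType) (E : {set {set V}}) (C : {set V}) : bool :=
  [forall u in C, forall w in C, (u != w) ==> ([set u; w] \in E)].

Definition complete_edges (V : finType) (S : {set V}) : {set {set V}} :=
  [set [set x; y] | x in S, y in S & x != y].

Inductive ktree (V : finType) (k : nat) : {set V} -> {set {set V}} -> Prop :=
| ktree_base (S : {set V}) :
    #|S| = k -> ktree k S (complete_edges S)
| ktree_step (S : {set V}) (E : {set {set V}}) (v : V) (K : {set V}) :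
    ktree k S E -> v \notin S -> K \subset S -> #|K| = k -> isclique E K ->
    ktree k (v |: S) (E :|: [set [set v; u] | u in K]).

Definition kclique (V : finType) (k : nat) (S : {set V}) (E : {set {set V}})
    (C : {set V}) : bool :=
  [&& C \subset S, #|C| == k & isclique E C].

Definition subktrees (V : finType) (k : nat) (S : {set V}) (E : {set {set V}})
    (C : {set V}) : {set {set V} * {set {set V}}} :=
  [set p : {set V} * {set {set V}} |
     [&& p.1 \subset S, p.2 \subset E, C \subset p.1, isclique p.2 C &
      `[< ktree k p.1 p.2 >] ]].

Definition Nsub (V : finType) (k : nat) (S : {set V}) (E : {set {set V}})
    (C : {set V}) : nat := #|subktrees k S E C|.

Definition Rsub (V : finType) (k : nat) (S : {set V}) (E : {set {set V}})
    (C : {set V}) : nat := \sum_(p in subktrees k S E C) #|p.1|.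

Definition mu (V : finType) (k : nat) (S : {set V}) (E : {set {set V}})
    (C : {set V}) : rat :=
  ((Rsub k S E C)%:R / (Nsub k S E C)%:R)%R.

Definition clique_degree (V : finType) (k : nat) (E : {set {set V}})
    (C : {set V}) : nat :=
  #|[set D : {set V} | [&& C \subset D, #|D| == k.+1 & isclique E D]]|.

(* Main.v *)
(* Root T at a k-clique C: every other vertex v is attached to a parent clique
   K v, and the sub-k-trees containing C correspond to the sets X containing C
   with K v inside X for all v in X \ C.  Let w_1, ..., w_d be the vertices with
   parent clique C.  The generating function of these sets is a product over
   the w_i, and for the bag B = w_i |: C it splits further as a product over
   the k+1 cliques B \ u of the bag.  With N_iu and m_iu the number and mean
   size of the closed sets hanging from B \ u away from B (u in C),
   P_i = prod_u N_iu and g_i = P_i (1 + sum_u m_iu) / (1 + P_i), this gives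
   mu(C) = k + sum_i g_i, and mu(B \ u) <= mu(C) amounts to
     g_i prod_(j != i) (1 + P_j) <= N_iu (sum_j g_j - m_iu).
   As k >= 2, the smallest N_iu, called a_i, satisfies a_i^2 <= P_i; together
   with m_iu <= (N_iu - 1) / 2 the inequalities for a maximal C force d = 1,
   or d = 2 and P_1 = P_2 = 1, that is n = k + 2. *)

Require Import Defs.
From HB Require Import structures.
From mathcomp Require Import all_boot all_order all_algebra.
From mathcomp Require Import boolp.
From mathcomp Require Import ring lra.
Import Order.TTheory GRing.Theory Num.Theory.
Set Implicit Arguments. Unset Strict Implicit. Unset Printing Implicit Defensive.

(** * Edges, cliques and rooted presentations of k-trees *)

Lemma set2_inj (T : finType) (x y a b : T) :
  [set x; y] = [set a; b] -> (x = a /\ y = b) \/ (x = b /\ y = a).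
Proof.
move=> e.
have := set21 x y; have := set22 x y; have := set21 a b; have := set22 a b.
rewrite -{1 2}e {3 4}e !inE => /orP[]/eqP-> /orP[]/eqP eax /orP[]/eqP ey /orP[]/eqP ex; subst; auto.
Qed.

Lemma iscliqueP (V : finType) (E : {set {set V}}) (C : {set V}) :
  reflect {in C &, forall u w, u != w -> [set u; w] \in E} (isclique E C).
Proof.
apply: (iffP forall_inP) => [h u w uC wC|h u uC].
  by move/forall_inP: (h u uC) => /(_ w wC) /implyP.
by apply/forall_inP => w wC; apply/implyP; apply: h.
Qed.

Lemma isclique_sub (V : finType) (E E' : {set {set V}}) (C C' : {set V}) :
  E \subset E' -> C' \subset C -> isclique E C -> isclique E' C'.
Proof.
move=> sE sC /iscliqueP h; apply/iscliqueP => u w uC wC uw.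
by apply: (subsetP sE); apply: h => //; apply: (subsetP sC).
Qed.

Lemma mem_complete_edges (V : finType) (S : {set V}) (x y : V) :
  x != y -> ([set x; y] \in complete_edges S) = (x \in S) && (y \in S).
Proof.
move=> xy; apply/imset2P/andP => [[a b aS]|[xS yS]].
  rewrite inE => /andP[bS _] /set2_inj[] [-> ->] //.
by exists x y => //; rewrite inE yS.
Qed.

(* The graph (S, E) is built from the complete graph on D by adding the
   other vertices in increasing rank r, each v being joined to the k-clique
   K v; used with #|D| = k and with #|D| = k.+1. *)
Record rooting (V : finType) (k : nat) (S D : {set V}) (E : {set {set V}})
    (K : V -> {set V}) (r : V -> nat) : Prop := Rooting {
  rooting_sub : D \subset S;
  rooting_pair : forall e, e \in E ->
    exists x y, [/\ x \in S, y \in S, x != y & e = [set x; y]];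
  rooting_adj : forall x y, x \in S -> y \in S -> x != y ->
    ([set x; y] \in E) = [|| (x \in D) && (y \in D),
                             (y \notin D) && (x \in K y) |
                             (x \notin D) && (y \in K x)];
  rooting_card : forall v, v \in S -> v \notin D -> #|K v| = k;
  rooting_clique : forall v, v \in S -> v \notin D -> isclique E (K v);
  rooting_in : forall v x, v \in S -> v \notin D -> x \in K v -> x \in S;
  rooting_rank : forall v x, v \in S -> v \notin D -> x \in K v ->
    x \notin D -> r x < r v }.

Lemma rooting_irr (V : finType) k (S D : {set V}) E K r v :
  rooting k S D E K r -> v \in S -> v \notin D -> v \notin K v.
Proof.
move=> hr vS vD; apply/negP => vK.
by have := rooting_rank hr vS vD vK vD; rewrite ltnn.
Qed.

Lemma rooting_root_clique (V : finType) k (S D : {set V}) E K r :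
  rooting k S D E K r -> isclique E D.
Proof.
move=> hr; apply/iscliqueP => u w uD wD uw.
have sDS := subsetP (rooting_sub hr).
by rewrite (rooting_adj hr) ?sDS // uD wD.
Qed.

(** For c in the root, the edge between w and c can only come from c being in [K w], so a clique
    forces C inside [K w]; both have k elements. *)
Lemma rooting_parent_clique (V : finType) k (S C : {set V}) E K r w :
  rooting k S C E K r -> #|C| = k -> w \in S -> w \notin C ->
  isclique E (w |: C) = (K w == C).
Proof.
move=> hr cC wS wC; apply/idP/eqP => [/iscliqueP cl|Kw].
  apply/esym/eqP; rewrite eqEcard cC (rooting_card hr wS wC) leqnn andbT.
  apply/subsetP => c cC'; have cw: c != w by apply: contraNneq wC => <-.
  have cS := subsetP (rooting_sub hr) _ cC'.
  have := cl c w; rewrite !inE cC' eqxx orbT => /(_ isT isT cw).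
  by rewrite (rooting_adj hr) // cC' (negbTE wC) /= orbF.
have sDS := subsetP (rooting_sub hr).
apply/iscliqueP => x y; rewrite !inE => /orP[/eqP->|xC] /orP[/eqP->|yC] xy.
- by rewrite eqxx in xy.
- by rewrite (rooting_adj hr) ?(sDS y) // wC Kw yC !orbT.
- by rewrite (rooting_adj hr) ?(sDS x) // wC Kw xC !orbT.
by rewrite (rooting_adj hr) ?sDS // xC yC.
Qed.

(** The edges from w to C change status only: they were parent edges of w and become root edges.
    This passes from a k-clique to a bag. *)
Lemma rooting_grow (V : finType) k (S C : {set V}) E K r w :
  rooting k S C E K r -> w \in S -> w \notin C -> K w = C ->
  rooting k S (w |: C) E K r.
Proof.
move=> hr wS wC Kw; split.
- by rewrite subUset sub1set wS (rooting_sub hr).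
- exact: rooting_pair hr.
- move=> x y xS yS xy; rewrite (rooting_adj hr) // !inE !negb_or.
  have [ex|xw] := eqVneq x w; have [ey|yw] := eqVneq y w; try subst x; try subst y; rewrite /= ?andbF ?andbT //=.
  + by rewrite eqxx in xy.
  + by rewrite (negbTE wC) Kw; case: (y \in C); case: (w \in K y).
  + by rewrite (negbTE wC) Kw; case: (x \in C); case: (w \in K x).
- by move=> v vS; rewrite !inE negb_or => /andP[_]; apply: (rooting_card hr vS).
- by move=> v vS; rewrite !inE negb_or => /andP[_]; apply: (rooting_clique hr vS).
- by move=> v x vS; rewrite !inE negb_or => /andP[_]; apply: (rooting_in hr vS).
move=> v x vS; rewrite !inE !negb_or => /andP[_ vC] xK /andP[_ xC].
exact: (rooting_rank hr vS vC xK xC).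
Qed.

(** The inverse move, towards any k-clique of the bag: u leaves the root and becomes a vertex with
    parent clique [B :\ u]. It gets rank 0 and all other ranks are shifted up, since u may lie in
    many parent cliques. *)
Lemma rooting_drop (V : finType) k (S B : {set V}) E K r u :
  rooting k S B E K r -> #|B| = k.+1 -> u \in B ->
  rooting k S (B :\ u) E (fun v => if v == u then B :\ u else K v)
    (fun v => if v == u then 0 else (r v).+1).
Proof.
move=> hr cB uB; have sBS := subsetP (rooting_sub hr).
have out v : v != u -> v \notin B :\ u -> v \notin B by rewrite !inE => ->.
split.
- by apply: subset_trans (rooting_sub hr); apply: subsetDl.
- exact: rooting_pair hr.
- move=> x y xS yS xy; rewrite (rooting_adj hr) // !inE.
  have [ex|xu] := eqVneq x u; have [ey|yu] := eqVneq y u; subst; rewrite /= ?andbF ?andbT //=.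
  + by rewrite eqxx in xy.
  + by rewrite uB !inE yu; case: (y \in B); case: (u \in K y).
  + by rewrite uB !inE xu; case: (x \in B); case: (u \in K x).
- move=> v vS; case: eqP => [_ _|/eqP vu /(out _ vu)]; last exact: (rooting_card hr vS).
  by move: (cardsD1 u B); rewrite uB cB => -[].
- move=> v vS; case: eqP => [_ _|/eqP vu /(out _ vu)]; last exact: (rooting_clique hr vS).
  by apply: isclique_sub (rooting_root_clique hr) => //; apply: subsetDl.
- move=> v x vS; case: eqP => [_ _|/eqP vu /(out _ vu)]; last exact: (rooting_in hr vS).
  by rewrite !inE => /andP[_]; apply: sBS.
move=> v x vS; case: eqP => [_ _ ->|/eqP vu /(out _ vu) vB xK] //.
by case: eqP => // /eqP xu /(out _ xu); apply: (rooting_rank hr vS vB xK).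
Qed.

Lemma mem_new_edges (V : finType) (E : {set {set V}}) (K0 : {set V}) v x y :
  x != v -> y != v ->
  ([set x; y] \in E :|: [set [set v; u] | u in K0]) = ([set x; y] \in E).
Proof.
move=> xv yv; rewrite inE; case: (boolP (_ \in E)) => //= _.
apply/imsetP => -[u _ /set2_inj[[ex _]|[_ ey]]].
  by rewrite ex eqxx in xv.
by rewrite ey eqxx in yv.
Qed.

(** The new vertex lies in no old parent clique, so a rank above all others is safe for it. *)
Lemma rooting_extend (V : finType) k (S D K0 : {set V}) E K r v :
  rooting k S D E K r -> v \notin S -> K0 \subset S -> #|K0| = k ->
  isclique E K0 ->
  rooting k (v |: S) D (E :|: [set [set v; u] | u in K0])
    (fun x => if x == v then K0 else K x)
    (fun x => if x == v then (\max_y r y).+1 else r x).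
Proof.
move=> hr vS sK cK clK; have sDS := subsetP (rooting_sub hr).
have nv x : x \in S -> x != v by apply: contraTneq => ->.
have vD : v \notin D by apply: contra vS; apply: sDS.
have vnE x : [set v; x] \notin E.
  apply/negP => /(rooting_pair hr)[a [b [aS bS _]]].
  by case/set2_inj => -[ea eb]; move: vS; rewrite ea ?eb ?aS ?bS.
have vadj x : ([set v; x] \in E :|: [set [set v; u] | u in K0]) = (x \in K0).
  rewrite inE (negbTE (vnE x)) /=; apply/imsetP/idP => [[u uK /set2_inj]|xK]; last by exists x.
  by case=> -[ev ->] //; rewrite ev.
have sub v0 : v0 \in v |: S -> v0 != v -> v0 \in S by rewrite !inE => /orP[->|].
split.
- by apply: subset_trans (rooting_sub hr) _; apply: subsetUr.
- move=> e; rewrite inE => /orP[/(rooting_pair hr)[x [y [xS yS xy ->]]]|/imsetP[u uK ->]].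
    by exists x, y; rewrite !inE xS yS !orbT.
    by exists v, u; rewrite !inE eqxx (subsetP sK u uK) orbT eq_sym nv ?(subsetP sK u uK).
- move=> x y xS yS xy.
  have [ex|xv] := eqVneq x v; have [ey|yv] := eqVneq y v; subst.
  + by rewrite eqxx in xy.
  + rewrite vadj (negbTE vD) /=; have yS' := sub _ yS yv.
    case: (boolP (y \in D)) => //= yD.
    by case: (boolP (v \in K y)) => // /(rooting_in hr yS' yD) vS'; rewrite vS' in vS.
  + rewrite [[set x; v]]setUC vadj (negbTE vD) andbF /=; have xS' := sub _ xS xv.
    rewrite orbC; case: (boolP (x \in D)) => //= xD.
    by case: (boolP (v \in K x)) => // /(rooting_in hr xS' xD) vS'; rewrite vS' in vS.
  by rewrite mem_new_edges // (rooting_adj hr) ?sub.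
- move=> x xS; case: eqP => // /eqP xv; exact: (rooting_card hr (sub _ xS xv)).
- move=> x xS; case: eqP => [_ _|/eqP xv xD].
    by apply: isclique_sub clK => //; apply: subsetUl.
  by apply: isclique_sub (rooting_clique hr (sub _ xS xv) xD) => //; apply: subsetUl.
- move=> x y xS; rewrite inE; case: eqP => [_ _ yK|/eqP xv xD yK].
    by rewrite (subsetP sK) ?orbT.
  by rewrite (rooting_in hr (sub _ xS xv) xD yK) orbT.
move=> x y xS; case: eqP => [_ _ yK yD|/eqP xv xD yK yD].
  by rewrite (negbTE (nv _ (subsetP sK _ yK))) ltnS leq_bigmax.
have xS' := sub _ xS xv.
by rewrite (negbTE (nv _ (rooting_in hr xS' xD yK))) (rooting_rank hr xS' xD).
Qed.

Lemma rooting_exists (V : finType) k (S : {set V}) E (C : {set V}) :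
  ktree k S E -> kclique k S E C -> exists K r, rooting k S C E K r.
Proof.
move=> kt; elim: kt C => {S E} [S cS|S E v K0 kt IH vS sK cK clK] C /and3P[sC /eqP cC clC].
  have -> : C = S by apply/eqP; rewrite eqEcard sC cC cS leqnn.
  exists (fun=> set0), (fun=> 0); split=> //.
  - move=> e /imset2P[x y xS]; rewrite inE => /andP[yS xy] ->.
    by exists x, y.
  - by move=> x y xS yS xy; rewrite mem_complete_edges // xS yS.
  - by move=> v vS; rewrite vS.
  - by move=> v vS; rewrite vS.
  - by move=> v x vS; rewrite vS.
  by move=> v x vS; rewrite vS.
case: (boolP (v \in C)) => vC; last first.
  have CS : C \subset S.
    apply/subsetP => x xC; move: (subsetP sC x xC); rewrite !inE => /orP[/eqP ex|//].
    by rewrite -ex xC in vC.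
  have [|K [r hr]] := IH C.
    apply/and3P; split => //; first exact/eqP.
    apply/iscliqueP => x y xC yC xy; move/iscliqueP: clC => /(_ x y xC yC xy).
    by rewrite mem_new_edges //; [apply: contraNneq vC => <-|apply: contraNneq vC => <-].
  by eexists; eexists; apply: (rooting_extend hr).
have [|K [r hr]] := IH K0; first by rewrite /kclique sK cK eqxx.
have hr' := rooting_extend hr vS sK cK clK.
have vK : v \notin K0 by apply: contra vS; apply: (subsetP sK).
have := rooting_grow hr' (setU11 _ _) vK; rewrite eqxx => /(_ erefl) hB.
(* Here C contains the last vertex v, so the rest of C consists of neighbours of v. Hence C is the
   bag [v |: K0] minus one vertex u, and rooting at [K0], growing by v and dropping u gives a
   rooting at C. *)
have sCK : C \subset v |: K0.
  apply/subsetP => x xC; rewrite !inE; have [//|xv] := eqVneq x v.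
  move/iscliqueP: clC => /(_ v x vC xC); rewrite eq_sym => /(_ xv).
  rewrite inE => /orP[h|/imsetP[u uK /set2_inj[[_ ->]//|[ev ->]]]]; last by rewrite ev.
  have [a [b [aS bS _]]] := rooting_pair hr h.
  by case/set2_inj => -[ea eb]; move: vS; rewrite ea ?eb ?aS ?bS.
have cB : #|v |: K0| = k.+1 by rewrite cardsU1 vK cK.
have /cards1P[u eu] : #|(v |: K0) :\: C| == 1.
  by rewrite cardsD (setIidPr sCK) cB cC subSnn.
have uB : u \in v |: K0 by have := set11 u; rewrite -eu inE => /andP[].
have -> : C = (v |: K0) :\ u.
  by rewrite -eu setDDr setDv set0U; apply/esym/setIidPr.
by eexists; eexists; apply: rooting_drop hB _ uB.
Qed.

(** * Sub-k-trees through C as sets closed under parents *)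

Definition induced (V : finType) (E : {set {set V}}) (X : {set V}) :=
  [set e in E | e \subset X].

Lemma mem_induced (V : finType) (E : {set {set V}}) (X : {set V}) x y :
  x \in X -> y \in X -> ([set x; y] \in induced E X) = ([set x; y] \in E).
Proof. by move=> xX yX; rewrite inE subUset !sub1set xX yX !andbT. Qed.

Lemma rooting_edges_eq (V : finType) k (S D : {set V}) E E' K K' r r' :
  rooting k S D E K r -> rooting k S D E' K' r' ->
  (forall v, v \in S -> v \notin D -> K v = K' v) -> E = E'.
Proof.
move=> h h' eK.
have adj x y : x \in S -> y \in S -> x != y -> ([set x; y] \in E) = ([set x; y] \in E').
  move=> xS yS xy; rewrite (rooting_adj h) // (rooting_adj h') //.
  congr [|| _, _ | _]; last by case: (boolP (x \in D)) => //= xD; rewrite eK.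
  by case: (boolP (y \in D)) => //= yD; rewrite eK.
apply/setP => e; apply/idP/idP => he.
  by have [x [y [xS yS xy ee]]] := rooting_pair h he; rewrite ee -adj // -ee.
by have [x [y [xS yS xy ee]]] := rooting_pair h' he; rewrite ee adj // -ee.
Qed.

Lemma rooting_induced (V : finType) k (S D X : {set V}) E K r :
  rooting k S D E K r -> D \subset X -> X \subset S ->
  (forall v, v \in X -> v \notin D -> K v \subset X) ->
  rooting k X D (induced E X) K r.
Proof.
move=> hr sDX /subsetP sXS cl; split=> //.
- move=> e; rewrite inE => /andP[/(rooting_pair hr)[x [y [xS yS xy ->]]]].
  by rewrite subUset !sub1set => /andP[xX yX]; exists x, y.
- move=> x y xX yX xy; rewrite mem_induced // (rooting_adj hr) ?sXS //.
- by move=> v vX; apply: (rooting_card hr (sXS _ vX)).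
- move=> v vX vD; have /iscliqueP clE := rooting_clique hr (sXS _ vX) vD.
  apply/iscliqueP => x y xK yK xy.
  by rewrite mem_induced ?clE // (subsetP (cl v vX vD)).
- by move=> v x vX vD; apply: (subsetP (cl v vX vD)).
by move=> v x vX vD; apply: (rooting_rank hr (sXS _ vX) vD).
Qed.

(** Converse of [rooting_exists], by removing vertices in decreasing rank. *)
Lemma rooting_ktree (V : finType) k (S C : {set V}) E K r :
  #|C| = k -> rooting k S C E K r -> ktree k S E.
Proof.
move=> cC; have [n] := ubnP #|S|; elim: n S E => // n IH S E leSn hr.
have [SC|/set0Pn[v0 v0SC]] := eqVneq (S :\: C) set0.
  have eS : S = C.
    by apply/eqP; rewrite eqEsubset (rooting_sub hr) andbT -setD_eq0 SC.
  (* With no vertex outside C, any two rootings have the same edges, so [E] is the complete edge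
     set. *)
  rewrite {}eS {SC leSn} in hr *; have kt := ktree_base cC.
  have cl : kclique k C (complete_edges C) C.
    rewrite /kclique subxx cC eqxx; apply/iscliqueP => x y xC yC xy.
    by rewrite mem_complete_edges // xC yC.
  have [K' [r' hr']] := rooting_exists kt cl.
  by rewrite (rooting_edges_eq hr hr') // => v ->.
have [v vSC vmax] := @arg_maxnP _ v0 (mem (S :\: C)) r v0SC.
have /setDP[vS vC] := vSC.
have sDS := subsetP (rooting_sub hr).
(* A vertex of maximal rank is in no parent clique, so the others form a closed set. *)
have cl x : x \in S :\ v -> x \notin C -> K x \subset S :\ v.
  rewrite inE => /andP[_ xS] xC; apply/subsetP => y yK.
  rewrite !inE (rooting_in hr xS xC yK) andbT; apply: contraTneq (vmax x _); last by rewrite /= !inE xS xC.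
  by move=> ey; subst y; rewrite /= -ltnNge (rooting_rank hr xS xC yK).
have sC : C \subset S :\ v.
  by apply/subsetP => c cC'; rewrite !inE sDS // andbT; apply: contraNneq vC => <-.
have hr' := rooting_induced hr sC (subsetDl _ _) cl.
have sK : K v \subset S :\ v.
  apply/subsetP => y yK; rewrite !inE (rooting_in hr vS vC yK) andbT.
  by apply: contraTneq yK => ->; apply: rooting_irr hr _ _.
have clK : isclique (induced E (S :\ v)) (K v).
  have /iscliqueP clE := rooting_clique hr vS vC.
  apply/iscliqueP => x y xK yK xy; rewrite mem_induced ?clE //; exact: (subsetP sK).
have vn : v \notin S :\ v by rewrite !inE eqxx.
have cK := rooting_card hr vS vC.
have hr2 := rooting_extend hr' vn sK cK clK.
have kt : ktree k (S :\ v) (induced E (S :\ v)).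
  by apply: IH hr'; rewrite [#|S|](cardsD1 v) vS in leSn.
have := ktree_step kt vn sK cK clK; rewrite setD1K // in hr2 *.
by rewrite -(rooting_edges_eq hr hr2) // => x _ _ /=; case: eqP => [->|].
Qed.

(** Take a counterexample w of maximal rank [r], and y in [K' w]. If y is not in [K w], the edge wy
    puts w in [K y], so y has larger rank and [K y = K' y]; then w and y are parents of each other
    under [K'], which is impossible. So [K' w] lies in [K w], and both have k elements. *)
Lemma rooting_unique (V : finType) k (S X C : {set V}) E E' K K' r r' :
  rooting k S C E K r -> rooting k X C E' K' r' -> X \subset S ->
  E' \subset E -> forall v, v \in X -> v \notin C -> K v = K' v.
Proof.
move=> h h' /subsetP sXS /subsetP sE v vX vC; apply/eqP; apply/negPn/negP => ne.
pose bad := [pred v | [&& v \in X, v \notin C & K v != K' v]].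
have [w /and3P[wX wC new] wmax] := @arg_maxnP _ v bad r (introT and3P (And3 vX vC ne)).
case/negP: new; rewrite eq_sym eqEcard (rooting_card h (sXS _ wX) wC).
rewrite (rooting_card h' wX wC) leqnn andbT; apply/subsetP => y yK'.
have yX := rooting_in h' wX wC yK'.
have wy : w != y by apply: contraTneq yK' => <-; apply: rooting_irr h' _ _.
have : [set w; y] \in E by apply: sE; rewrite (rooting_adj h') // wC yK' !orbT.
rewrite (rooting_adj h) ?sXS // (negbTE wC) /= => /orP[/andP[yC wK]|//].
have rwy := rooting_rank h (sXS _ yX) yC wK wC.
have eKy : K y = K' y.
  apply/eqP; apply/negPn/negP => ney.
  by have := wmax y; rewrite /= yX yC ney leqNgt rwy => /(_ isT).
rewrite eKy in wK; have := rooting_rank h' yX yC wK wC.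
by rewrite ltnNge ltnW // (rooting_rank h' wX wC yK' yC).
Qed.

(** Y is the part of a vertex set outside the root D, so that its size counts non-root vertices
    only. *)
Definition closed_over (V : finType) (D : {set V}) (K : V -> {set V})
    (Y : {set V}) : bool :=
  [disjoint Y & D] && [forall v in Y, K v \subset D :|: Y].

Lemma closed_overP (V : finType) (D : {set V}) (K : V -> {set V}) (Y : {set V}) :
  reflect ([disjoint Y & D] /\
           forall v x, v \in Y -> x \in K v -> x \notin D -> x \in Y)
          (closed_over D K Y).
Proof.
apply: (iffP andP) => -[dYD cl]; split=> //.
  move=> v x vY xK xD; move/forall_inP: cl => /(_ v vY)/subsetP/(_ x xK).
  by rewrite inE (negbTE xD).
apply/forall_inP => v vY; apply/subsetP => x xK; rewrite inE.
by case: (boolP (x \in D)) => //= xD; apply: cl xK xD.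
Qed.

(** A sub-k-tree containing C can itself be rooted at C, and by [rooting_unique] its parent cliques
    are those of the whole graph; so it is induced and closed. Conversely, a closed set inherits the
    rooting. *)
Lemma subktrees_closed (V : finType) k (C : {set V}) E K r p :
  #|C| = k -> rooting k setT C E K r ->
  (p \in subktrees k setT E C) =
  [&& p.2 == induced E p.1, C \subset p.1 & closed_over C K (p.1 :\: C)].
Proof.
case: p => X E' cC hr; rewrite inE /= subsetT /=; apply/and4P/and3P.
  move=> [sE sC cl /asboolP kt].
  have [|K' [r' hr']] := rooting_exists kt (C := C); first by rewrite /kclique sC cC eqxx.
  have eK := rooting_unique hr hr' (subsetT _) sE.
  have cls v : v \in X -> v \notin C -> K v \subset X.
    by move=> vX vC; rewrite eK //; apply/subsetP => x; apply: (rooting_in hr' vX vC).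
  split=> //.
    apply/eqP/(rooting_edges_eq hr' (rooting_induced hr sC (subsetT _) cls)) => v vX vC.
    by rewrite eK.
  apply/closed_overP; split; first by rewrite disjoints_subset subsetDr.
  move=> v x; rewrite !inE => /andP[vC vX] xK -> /=.
  exact: (subsetP (cls v vX vC)).
move=> [/eqP -> sC /closed_overP[_ cls]].
have {}cls v : v \in X -> v \notin C -> K v \subset X.
  move=> vX vC; apply/subsetP => x xK; case: (boolP (x \in C)) => [|xC]; first exact: subsetP.
  by have := cls v x; rewrite !inE vX vC xC => /(_ isT xK isT).
have hr' := rooting_induced hr sC (subsetT _) cls.
split=> //; first by apply/subsetP => e; rewrite inE => /andP[].
  exact: rooting_root_clique hr'.
by apply/asboolP; apply: rooting_ktree hr'.
Qed.

Lemma big_subktrees (V : finType) (R : nmodType) k (C : {set V}) E K r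
    (f : {set V} -> R) :
  #|C| = k -> rooting k setT C E K r ->
  (\sum_(p in subktrees k setT E C) f p.1 =
   \sum_(Y : {set V} | closed_over C K Y) f (C :|: Y))%R.
Proof.
move=> cC hr.
rewrite (reindex_onto (fun Y : {set V} => (C :|: Y, induced E (C :|: Y)))
  (fun p => p.1 :\: C)) /=.
  apply: eq_bigl => Y; rewrite (subktrees_closed _ cC hr) /= eqxx subsetUl /=.
  have e : [disjoint Y & C] -> (C :|: Y) :\: C = Y.
    by move=> d; rewrite setDUl setDv set0U; apply/setDidPl.
  apply/andP/idP => [[h /eqP <-]//|h].
  by have /closed_overP[d _] := h; rewrite e.
move=> [X E'] /=; rewrite (subktrees_closed _ cC hr) /= => /and3P[/eqP -> sC _].
have -> // : C :|: X :\: C = X.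
by apply/setP => x; rewrite !inE; case: (boolP (x \in C)) => // /(subsetP sC) ->.
Qed.

(** * Branch labels, generating functions and their factorisations *)

Lemma rooting_ind (V : finType) k (D : {set V}) E K r (P : V -> Prop) :
  rooting k setT D E K r ->
  (forall x, x \notin D ->
     (forall y, y \in K x -> y \notin D -> P y) -> P x) ->
  forall x, x \notin D -> P x.
Proof.
move=> hr step x; have [n] := ubnP (r x).
elim: n x => // n IH x le xD; apply: step => // y yK yD; apply: IH => //.
by apply: leq_trans (rooting_rank hr (in_setT x) xD yK yD) _.
Qed.

(** Labels propagate from parents to children. They are well defined because the parents of a vertex
    form a clique: of two adjacent parents outside D, one lies in the parent clique of the other. *)
Lemma branch_labels (V : finType) k (D : {set V}) E K r (i0 : V -> V) :
  rooting k setT D E K r ->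
  exists b : V -> V, forall x, x \notin D ->
    (K x \subset D -> b x = i0 x) /\
    (forall y, y \in K x -> y \notin D -> b y = b x).
Proof.
move=> hr.
suff [b hb] : exists b : V -> V, forall x, x \notin D -> r x < (\max_y r y).+1 ->
    (K x \subset D -> b x = i0 x) /\
    (forall y, y \in K x -> y \notin D -> b y = b x).
  by exists b => x xD; apply: hb; rewrite // ltnS leq_bigmax.
elim: (_.+1) => [|n [b hb]]; first by exists id.
(* Labels are already known below rank n; at rank n a vertex copies an arbitrary parent outside D,
   or takes [i0 x] if it has none. *)
pose b' x := if r x < n then b x else
  if [pick y | (y \in K x) && (y \notin D)] is Some y then b y else i0 x.
exists b' => x xD lex.
have rk y : y \in K x -> y \notin D -> r y < r x.
  by move=> yK yD; apply: (rooting_rank hr _ xD).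
have lt y : y \in K x -> y \notin D -> r y < n.
  by move=> yK yD; apply: leq_trans (rk y yK yD) _.
rewrite /b'; case: (ltnP (r x) n) => [ltx|_].
  have [h1 h2] := hb x xD ltx; split=> // y yK yD.
  by rewrite (ltn_trans (rk y yK yD) ltx) h2.
split=> [sKD|y yK yD]; first by case: pickP => // y /andP[/(subsetP sKD) ->].
rewrite lt //; case: pickP => [z /andP[zK zD]|/(_ y)]; last by rewrite yK yD.
have [->//|yz] := eqVneq y z.
have /iscliqueP/(_ y z yK zK yz) := rooting_clique hr (in_setT _) xD.
rewrite (rooting_adj hr) // (negbTE yD) zD /= => /orP[yKz|zKy].
  by have [_ ->] := hb z zD (lt z zK zD).
by have [_ ->] := hb y yD (lt y yK yD).
Qed.

Definition gfam (V : finType) (P : pred {set V}) : {poly rat} :=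
  (\sum_(Y : {set V} | P Y) 'X^#|Y|)%R.

Definition labelled (V : finType) (D : {set V}) (K : V -> {set V}) (b : V -> V)
    (J : {set V}) : pred {set V} :=
  [pred Y | closed_over D K Y && (Y \subset b @^-1: J)].

(** Parents outside D share the label of their child, so a set is closed exactly when its two label
    classes are; sizes add, hence polynomials multiply. *)
Lemma gfam_labelledU (V : finType) (D : {set V}) (K : V -> {set V}) (b : V -> V)
    (J1 J2 : {set V}) :
  (forall x y, x \notin D -> y \in K x -> y \notin D -> b y = b x) ->
  [disjoint J1 & J2] ->
  gfam (labelled D K b (J1 :|: J2)) =
  (gfam (labelled D K b J1) * gfam (labelled D K b J2))%R.
Proof.
move=> hb dJ; rewrite /gfam /labelled big_distrlr pair_big /=.
have dis x : b x \in J1 -> b x \notin J2 by move=> h; rewrite (disjointFr dJ h).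
rewrite [RHS](reindex_onto (fun Y : {set V} => (Y :&: b @^-1: J1, Y :&: b @^-1: J2))
  (fun p => p.1 :|: p.2)) /=.
  apply: eq_big => [Y|Y /andP[_ sY]]; last first.
    rewrite -exprD; congr ('X^_)%R.
    rewrite -cardsUI -setIUr -preimsetU (setIidPl sY).
    rewrite setIACA setIid -preimsetI.
    by rewrite (disjoint_setI0 dJ) preimset0 setI0 cards0 addn0.
  have cl J : closed_over D K Y -> closed_over D K (Y :&: b @^-1: J).
    move=> /closed_overP[dYD cl]; apply/closed_overP; split.
      by apply: disjointWl dYD; apply: subsetIl.
    move=> v x; rewrite !inE => /andP[vY vJ] xK xD.
    have vD : v \notin D by rewrite (disjointFr dYD vY).
    by rewrite (cl v x) // (hb v x).
  rewrite !subsetIr !andbT -setIUr -preimsetU.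
  apply/andP/andP => [[cY sY]|[/andP[/closed_overP[d1 c1] /closed_overP[d2 c2]] /eqP eY]].
    by rewrite !cl // (setIidPl sY).
  have sY : Y \subset b @^-1: (J1 :|: J2) by rewrite -eY subsetIr.
  split=> //; apply/closed_overP.
  have eY2 : Y = (Y :&: b @^-1: J1) :|: (Y :&: b @^-1: J2).
    by rewrite -setIUr -preimsetU.
  split; first by rewrite eY2 disjoints_subset subUset -!disjoints_subset d1.
  move=> v x; rewrite {1}eY2 inE => /orP[vY|vY] xK xD.
    by have := c1 v x vY xK xD; rewrite inE => /andP[].
  by have := c2 v x vY xK xD; rewrite inE => /andP[].
move=> [Y1 Y2] /= /andP[/andP[_ /subsetP s1] /andP[_ /subsetP s2]].
congr (_, _); apply/setP => x; rewrite !inE.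
  case: (boolP (x \in Y1)) => /= [/s1|_]; first by rewrite inE => ->.
  case: (boolP (x \in Y2)) => //= /s2; rewrite inE => h.
  by apply/negP => /dis; rewrite h.
case: (boolP (x \in Y2)) => /= [/s2|_]; first by rewrite orbT inE => ->.
rewrite orbF; case: (boolP (x \in Y1)) => //= /s1; rewrite inE => h.
by apply/negbTE/dis.
Qed.

Lemma closed_over0 (V : finType) (D : {set V}) (K : V -> {set V}) :
  closed_over D K set0.
Proof.
by apply/closed_overP; split=> [|v x]; [rewrite disjoints_subset sub0set | rewrite inE].
Qed.

Lemma gfam_labelled (V : finType) (D : {set V}) (K : V -> {set V}) (b : V -> V)
    (J : {set V}) :
  (forall x y, x \notin D -> y \in K x -> y \notin D -> b y = b x) ->
  gfam (labelled D K b J) = (\prod_(i in J) gfam (labelled D K b [set i]))%R.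
Proof.
move=> hb; have [n] := ubnP #|J|; elim: n J => // n IH J leJ.
have [->|/set0Pn[i iJ]] := eqVneq J set0.
  rewrite big_set0 /gfam (big_pred1 set0) ?cards0 ?expr0 // => Y.
  rewrite /labelled /= preimset0 subset0 andbC; case: eqP => // ->.
  by rewrite closed_over0.
rewrite -(setD1K iJ) gfam_labelledU //; last by rewrite disjoints_subset sub1set !inE eqxx.
rewrite big_setU1 ?inE ?eqxx //= [gfam (labelled _ _ _ (J :\ i))]IH //.
by move: leJ; rewrite (cardsD1 i) iJ.
Qed.

Lemma eq_gfam (V : finType) (P Q : pred {set V}) : P =1 Q -> gfam P = gfam Q.
Proof. exact: eq_bigl. Qed.

Lemma gfam1 (V : finType) (P : pred {set V}) : ((gfam P).[1] = #|P|%:R)%R.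
Proof.
rewrite /gfam horner_sum (eq_bigr (fun=> 1%R)) => [|Y _]; last by rewrite hornerXn expr1n.
by rewrite sumr_const.
Qed.

Lemma gfam_deriv1 (V : finType) (P : pred {set V}) :
  ((gfam P)^`().[1] = \sum_(Y : {set V} | P Y) #|Y|%:R)%R.
Proof.
rewrite /gfam raddf_sum horner_sum; apply: eq_bigr => Y _.
by rewrite /= derivXn hornerMn hornerXn expr1n.
Qed.

(** The logarithmic derivative at 1, hence additive over products. *)
Definition mean (p : {poly rat}) : rat := (p^`().[1] / p.[1])%R.

Lemma mu_mean (V : finType) k (C : {set V}) E K r :
  #|C| = k -> rooting k setT C E K r ->
  (mu k setT E C = k%:R + mean (gfam (closed_over C K)))%R.
Proof.
move=> cC hr.
have eN : ((Nsub k setT E C)%:R = (gfam (closed_over C K)).[1] :> rat)%R.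
  rewrite gfam1 /Nsub -sum1_card (big_subktrees (fun=> 1%N) cC hr).
  by rewrite sum1_card.
have N0 : ((gfam (closed_over C K)).[1] != 0)%R.
  rewrite gfam1 pnatr_eq0 -lt0n; apply/card_gt0P; exists set0.
  exact: closed_over0.
rewrite /mu eN /Rsub (big_subktrees (fun X : {set V} => #|X|) cC hr) /mean.
apply: (mulIf N0); rewrite mulrDl !mulfVK //.
rewrite gfam_deriv1 gfam1 -natrM -natr_sum -natrD; congr (_%:R)%R.
rewrite (eq_bigr (fun Y : {set V} => k + #|Y|)) => [|Y /closed_overP[d _]].
  by rewrite big_split /= sum_nat_const mulnC.
by rewrite cardsU cC setIC (disjoint_setI0 d) cards0 subn0.
Qed.

(** The closed sets hanging from the clique [B :\ u] away from the bag; their number and mean are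
    N_iu and m_iu of the overview. *)
Definition side_family (V : finType) (B : {set V}) (K : V -> {set V}) (u : V) :
    pred {set V} :=
  [pred Y | closed_over (B :\ u) K Y && (u \notin Y)].

(** The label names a bag vertex that the parent clique of x misses. If x inherits it from y outside
    B and [b y] were in [K x], then [b y] and y would be adjacent, putting [b y] in [K y]. *)
Lemma bag_labels (V : finType) k (B : {set V}) E K r :
  #|B| = k.+1 -> rooting k setT B E K r ->
  exists b : V -> V,
    [/\ forall x, x \notin B -> b x \in B /\ b x \notin K x
      & forall x y, x \notin B -> y \in K x -> y \notin B -> b y = b x].
Proof.
move=> cB hr.
(* The default x is never taken when [K x] lies in B, since k elements cannot exhaust k + 1. *)
have [b hb] := branch_labels (fun x => odflt x [pick u in B :\: K x]) hr.
exists b; split=> [|x y xB]; last by have [_ h] := hb x xB; apply: h.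
apply: (rooting_ind hr) => x xB IH.
have [h1 h2] := hb x xB.
have cK := rooting_card hr (in_setT x) xB.
have [sKB|/subsetPn[y yK yB]] := boolP (K x \subset B).
  rewrite h1 //; case: pickP => [u|h]; first by rewrite inE => /andP[].
  have : #|B :\: K x| = 0 by apply: eq_card0 => u; rewrite h.
  by rewrite cardsD (setIidPr sKB) cB cK subSnn.
have [yB' _] := IH y yK yB; rewrite -(h2 y yK yB); split=> //; apply/negP => bK.
have by_ : b y != y by apply: contraNneq yB => <-.
have /iscliqueP/(_ _ _ bK yK by_) := rooting_clique hr (in_setT x) xB.
rewrite (rooting_adj hr) // yB' (negbTE yB) /= orbF => h.
by have [_] := IH y yK yB; rewrite h.
Qed.

(** The closed sets with all labels u are exactly the side family of u: a vertex labelled u never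
    has u as a parent, and conversely a set closed over [B :\ u] without u starts at vertices with
    parent clique [B :\ u], whose label must be u. *)
Lemma bag_factor (V : finType) k (B : {set V}) E K r :
  #|B| = k.+1 -> rooting k setT B E K r ->
  gfam (closed_over B K) = (\prod_(u in B) gfam (side_family B K u))%R.
Proof.
move=> cB hr; have [b [hB hb]] := bag_labels cB hr.
have -> : gfam (closed_over B K) = gfam (labelled B K b B).
  apply: eq_gfam => Y; rewrite /labelled /=; apply/idP/andP => [cl|[] //]; split=> //.
  apply/subsetP => x xY; rewrite inE.
  by case/closed_overP: cl => d _; have [] := hB x (negbT (disjointFr d xY)).
rewrite gfam_labelled //; apply: eq_bigr => u uB; apply: eq_gfam => Y.
rewrite /labelled /side_family /=; apply/andP/andP => -[/closed_overP[d cl]].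
  move=> /subsetP sY; split; last by apply: contraTN uB => /(disjointFr d) ->.
  apply/closed_overP; split.
    by rewrite disjoint_sym; apply: disjointWl (subsetDl _ _) _; rewrite disjoint_sym.
  move=> v x vY xK; have vB : v \notin B by rewrite (disjointFr d vY).
  rewrite !inE negb_and negbK => /orP[/eqP ex|]; last exact: (cl v x vY xK).
  have [_] := hB v vB; have := sY v vY; rewrite !inE => /eqP ->.
  by rewrite -ex xK.
move=> uY; have dB : [disjoint Y & B].
  rewrite -setI_eq0; apply/eqP/setP => x; rewrite !inE.
  apply/negP => /andP[xY xB]; have := disjointFr d xY; rewrite !inE xB andbT.
  by move/negbFE/eqP => ex; rewrite -ex xY in uY.
have out x : x \notin B -> x \notin B :\ u by rewrite !inE negb_and negbK orbC => ->.
split; first by apply/closed_overP; split=> // v x vY xK /out; apply: cl xK.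
suff h : forall v, v \notin B -> v \in Y -> b v = u.
  by apply/subsetP => v vY; rewrite !inE h // (disjointFr dB vY).
apply: (rooting_ind hr) => v vB IH vY.
have [sKB|/subsetPn[y yK yB]] := boolP (K v \subset B); last first.
  by rewrite -(hb v y) // IH //; apply: (cl v y vY yK (out _ yB)).
have uK : u \notin K v.
  by apply: contra uY => uK; apply: (cl v u vY uK); rewrite !inE eqxx.
have eK : K v = B :\ u.
  apply/eqP; rewrite eqEcard (rooting_card hr (in_setT v) vB).
  rewrite (cardsD1 u) uB add1n in cB; case: cB => ->; rewrite leqnn andbT.
  by rewrite subsetD1 sKB.
have [bB] := hB v vB; rewrite eK !inE bB andbT negbK.
by move/eqP.
Qed.

(** A closed set either avoids u or is u together with a set closed over the whole bag; u itself
    accounts for the factor ['X]. The parent map is the one from [rooting_drop]. *)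
Lemma clique_split (V : finType) (B : {set V}) K u :
  u \in B ->
  gfam (closed_over (B :\ u) (fun v => if v == u then B :\ u else K v)) =
  (gfam (side_family B K u) + 'X * gfam (closed_over B K))%R.
Proof.
move=> uB; rewrite /gfam (bigID (fun Y : {set V} => u \notin Y)) /=; congr (_ + _)%R.
  apply: eq_bigl => Y; rewrite /side_family /=; case: (boolP (u \in Y)); rewrite ?andbF // => uY.
  have nu v : v \in Y -> v != u by apply: contraTneq => ->.
  rewrite !andbT; apply/closed_overP/closed_overP => -[d cl]; split=> // v x vY xK.
    by apply: (cl v) => //; rewrite (negbTE (nu v vY)).
  by apply: (cl v) => //; rewrite (negbTE (nu v vY)) in xK.
rewrite big_distrr /= (reindex_onto (fun Y => u |: Y) (fun Y => Y :\ u)) /=; last first.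
  by move=> Y /andP[_]; rewrite negbK => /setD1K.
apply: eq_big => [Y|Y /andP[/andP[_ _] /eqP eY]]; last first.
  have uY : u \notin Y by rewrite -eY !inE eqxx.
  by rewrite cardsU1 uY exprS.
rewrite !inE eqxx /= andbT; apply/andP/idP => [[/closed_overP[d cl] /eqP eY]|/closed_overP[d cl]].
  have uY : u \notin Y by rewrite -eY !inE eqxx.
  have nu v : v \in Y -> v != u by apply: contraTneq => ->.
  apply/closed_overP; split.
    rewrite -setI_eq0; apply/eqP/setP => x; rewrite !inE; apply/negP => /andP[xY xB].
    have := @disjointFr _ _ _ x d; rewrite !inE xY orbT => /(_ isT).
    by rewrite nu // xB.
  move=> v x vY xK xB; have := cl v x; rewrite !inE vY orbT (negbTE (nu v vY)) xK.
  rewrite negb_and xB orbT => /(_ isT isT isT) /orP[/eqP ex|//].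
  by rewrite ex uB in xB.
have uY : u \notin Y by rewrite (disjointFl d uB).
have nu v : v \in Y -> v != u by apply: contraTneq => ->.
split; last by rewrite setU1K.
apply/closed_overP; split.
  rewrite -setI_eq0; apply/eqP/setP => x; rewrite !inE.
  case: eqP => //= _; case: (boolP (x \in Y)) => //= xY.
  by rewrite (disjointFr d xY).
move=> v x; rewrite !inE => /orP[/eqP ->|vY].
  by rewrite eqxx !inE => ->.
rewrite (negbTE (nu v vY)) negb_and negbK => xK /orP[->//|xB].
by rewrite (cl v x) ?orbT.
Qed.

(** Here the label of x is the child of C from which x descends. *)
Lemma child_labels (V : finType) k (C : {set V}) E K r :
  rooting k setT C E K r -> #|C| = k ->
  exists b : V -> V,
    [/\ forall x, x \notin C -> b x \notin C /\ K (b x) = C,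
        forall x, x \notin C -> K x = C -> b x = x
      & forall x y, x \notin C -> y \in K x -> y \notin C -> b y = b x].
Proof.
move=> hr cC; have [b hb] := branch_labels id hr.
exists b; split=> [|x xC eK|x y xC]; last by have [_ h] := hb x xC; apply: h.
  apply: (rooting_ind hr) => x xC IH.
  have [h1 h2] := hb x xC.
  have [sKC|/subsetPn[y yK yC]] := boolP (K x \subset C).
    rewrite h1 //; split=> //; apply/eqP.
    by rewrite eqEcard sKC cC (rooting_card hr (in_setT x) xC) leqnn.
  by rewrite -(h2 y yK yC); apply: IH.
by have [h _] := hb x xC; rewrite h // eK.
Qed.

(** [P w] collects the closed sets inside the branch of w. As every nonempty one contains w,
    avoiding w means using the other branches only. *)
Lemma branch_factor (V : finType) k (C : {set V}) E K r (W : {set V}) :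
  rooting k setT C E K r -> #|C| = k ->
  W = [set w | (w \notin C) && (K w == C)] ->
  exists P : V -> pred {set V},
    [/\ gfam (closed_over C K) = (\prod_(w in W) gfam (P w))%R,
        forall w, w \in W ->
          gfam (side_family (w |: C) K w) = (\prod_(i in W :\ w) gfam (P i))%R
      & forall w, w \in W -> P w set0].
Proof.
move=> hr cC eW; have [b [hC hid hb]] := child_labels hr cC.
have bW x : x \notin C -> b x \in W.
  by move=> /hC[bC Kb]; rewrite eW inE bC Kb eqxx.
exists (fun w => labelled C K b [set w]); split.
- rewrite -gfam_labelled //; apply: eq_gfam => Y.
  rewrite /labelled /=; apply/idP/andP => [cl|[] //]; split=> //.
  apply/subsetP => x xY; rewrite inE bW //.
  by case/closed_overP: cl => d _; rewrite (disjointFr d).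
- move=> w wW; rewrite -gfam_labelled //; apply: eq_gfam => Y.
  have /andP[wC /eqP Kw] : (w \notin C) && (K w == C) by rewrite eW inE in wW.
  rewrite /labelled /side_family /= setU1K //.
  case: (boolP (closed_over C K Y)) => //= /closed_overP[d cl].
  have YC x : x \in Y -> x \notin C by move=> xY; rewrite (disjointFr d xY).
  apply/idP/subsetP => [wY|h]; last first.
    by apply/negP => wY; have := h w wY; rewrite !inE hid // ?eqxx.
  suff h : forall x, x \notin C -> x \in Y -> b x != w.
    by move=> x xY; rewrite !inE bW ?YC // h ?YC.
  apply: (rooting_ind hr) => x xC IH xY.
  have [sKC|/subsetPn[y yK yC]] := boolP (K x \subset C).
    have eK : K x = C.
      by apply/eqP; rewrite eqEcard sKC cC (rooting_card hr (in_setT x) xC) leqnn.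
    by rewrite hid //; apply: contraNneq wY => <-.
  by rewrite -(hb x y) // IH //; apply: (cl x y xY yK yC).
by move=> w _; rewrite /labelled /= closed_over0 sub0set.
Qed.

(** * The numerical inequalities *)

Local Open Scope ring_scope.

Lemma exp2_le_prod_succ (I : finType) (A : {set I}) (P : I -> nat) :
  (forall i, i \in A -> (0 < P i)%N) ->
  2 ^+ #|A| <= \prod_(i in A) (P i).+1%:R :> rat.
Proof.
move=> h; rewrite -prodr_const; apply: ler_prod => i iA.
by rewrite ler0n ler_nat ltnS h.
Qed.

(** The numerical core, with [a], [P], [g] as in the overview. For the two largest values of [a], at
    w1 and w2, the inequality at w1 is played against the sum of the others. *)
Lemma two_trivial_branches (I : finType) (W : {set I}) (a P : I -> nat)
    (g : I -> rat) :
  (1 < #|W|)%N ->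
  (forall w, w \in W -> (0 < a w)%N) ->
  (forall w, w \in W -> (a w ^ 2 <= P w)%N) ->
  (forall w, w \in W -> (a w)%:R * (P w).+1%:R * g w <= (P w)%:R ^+ 2) ->
  (forall w, w \in W -> 1 / 2 <= g w) ->
  (forall w, w \in W -> (1 < P w)%N -> 1 <= g w) ->
  (forall w, w \in W ->
     g w * \prod_(v in W :\ w) (P v).+1%:R <= (a w)%:R * \sum_(v in W) g v) ->
  #|W| = 2 /\ forall w, w \in W -> P w = 1%N.
Proof.
move=> W2 a0 aP ag gh g1 key.
have P0 w : w \in W -> (0 < P w)%N.
  by move=> wW; apply: leq_trans (aP w wW); rewrite expn_gt0 a0.
have /card_gt0P[w0 w0W] : (0 < #|W|)%N by rewrite ltnW.
have [w1 w1W max1] := @arg_maxnP _ w0 (mem W) a w0W; rewrite /= in w1W max1.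
have cW1 : #|W| = #|W :\ w1|.+1 by rewrite (cardsD1 w1) w1W.
have /card_gt0P[w0' w0W'] : (0 < #|W :\ w1|)%N by rewrite cW1 in W2.
have [w2 w2W' max2] := @arg_maxnP _ w0' (mem (W :\ w1)) a w0W'.
rewrite /= in w2W' max2; have /setD1P[w21 w2W] := w2W'.
pose G := \sum_(v in W :\ w1) g v.
have eM : \sum_(v in W) g v = g w1 + G by rewrite (big_setD1 w1).
have M0 : 0 <= g w1 + G.
  by rewrite -eM; apply: sumr_ge0 => i iW; apply: le_trans (gh i iW).
have cW2 : #|W :\ w1| = #|W :\ w1 :\ w2|.+1 by rewrite (cardsD1 w2) w2W'.
have key1 : (P w1).+1%:R * G <= (a w2)%:R * (g w1 + G).
  (* For i other than w1 the product contains [(P w1).+1] and n further factors, each at least 2.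
     Summing over the n + 1 indices costs only n + 1 <= 2^n. *)
  set n := #|W :\ w1 :\ w2| in cW2.
  have hi i : i \in W :\ w1 -> g i * ((P w1).+1%:R * 2 ^+ n) <= (a w2)%:R * (g w1 + G).
    move=> iW'; have /setD1P[iw1 iW] := iW'.
    apply: le_trans (_ : (a i)%:R * (g w1 + G) <= _); last first.
      by rewrite ler_wpM2r // ler_nat max2.
    rewrite -eM; apply: le_trans (key i iW); apply: ler_wpM2l; first by apply: le_trans (gh i iW).
    have w1i : w1 \in W :\ i by rewrite !inE eq_sym iw1.
    rewrite (big_setD1 w1) //=; apply: ler_wpM2l; first by rewrite ler0n.
    have -> : n = #|W :\ i :\ w1|.
      have := cW1; rewrite (cardsD1 i) iW (cardsD1 w1 (W :\ i)) w1i cW2.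
      by move=> [].
    by apply: exp2_le_prod_succ => j /setD1P[_ /setD1P[_ jW]]; apply: P0.
  have := ler_sum (index_enum I) hi; rewrite -mulr_suml sumr_const cW2 -/G => h.
  have n2 : (n.+1%:R : rat) <= 2 ^+ n by rewrite -natrX ler_nat ltn_expl.
  have n20 : 0 < 2 ^+ n :> rat by rewrite exprn_gt0.
  rewrite -(ler_pM2r n20); apply: le_trans (_ : G * ((P w1).+1%:R * 2 ^+ n) <= _); first by lra.
  apply: le_trans h _; rewrite -[_ *+ n.+1]mulr_natr; apply: ler_wpM2l => //.
  by rewrite mulr_ge0.
have key2 := key w1 w1W; rewrite eM in key2.
have Gh : #|W :\ w1|%:R / 2 <= G.
  rewrite mulr_natl -sumr_const; apply: ler_sum => i /setD1P[_ iW].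
  by have := gh i iW; lra.
have a0' := a0 w1 w1W; have aP1 := aP w1 w1W; have aP2 := aP w2 w2W.
have ag1 := ag w1 w1W; have gh1 := gh w1 w1W.
move: (max1 w2 w2W); rewrite leq_eqVlt => /orP[/eqP eA|lA].
  rewrite eA in key1 aP2 *; set A := a w1 in key1 key2 aP1 aP2 a0' ag1 eA *.
  have aP1' : A%:R ^+ 2 <= (P w1)%:R :> rat by rewrite -natrX ler_nat.
  have aP2' : A%:R ^+ 2 <= (P w2)%:R :> rat by rewrite -natrX ler_nat.
  have A1 : 1 <= A%:R :> rat by rewrite ler1n.
  rewrite -addn1 natrD in key1.
  have [n0|n0] := posnP #|W :\ w1 :\ w2|.
    have eW : W :\ w1 = [set w2].
      by apply/esym/eqP; rewrite eqEcard sub1set w2W' cards1 cW2 n0.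
    have eG : G = g w2 by rewrite /G eW big_set1.
    have gh2 := gh w2 w2W.
    rewrite eW big_set1 -addn1 natrD in key2; rewrite eG in key1 key2 *.
    set x := g w1 in key1 key2 gh1 *; set y := g w2 in key1 key2 gh2 *.
    (* Adding [key1] and [key2] gives (1 + A^2)(x + y) <= 2A(x + y). *)
    have eA1 : A%:R = 1 :> rat.
      have : (A%:R - 1) ^+ 2 <= 0 :> rat by nra.
      by rewrite real_exprn_even_le0 ?num_real //= => /eqP; lra.
    rewrite eA1 in key1 key2.
    have k1 : (P w1)%:R * y <= x by lra.
    have k2 : (P w2)%:R * x <= y by lra.
    have pp : (P w1)%:R * (P w2)%:R <= 1 :> rat.
      have p2 : 0 <= (P w2)%:R :> rat by rewrite ler0n.
      have := ler_wpM2l p2 k1; nra.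
    have eP : (P w1 * P w2 <= 1)%N by rewrite -(ler_nat rat) natrM.
    have p1 := P0 w1 w1W; have p2 := P0 w2 w2W.
    have : (P w1 * P w2 == 1)%N by rewrite eqn_leq eP muln_gt0 p1.
    rewrite muln_eq1 => /andP[/eqP e1 /eqP e2].
    split; first by rewrite cW1 cW2 n0.
    move=> w; have [->//|ww1] := eqVneq w w1.
    move=> wW; have : w \in W :\ w1 by rewrite !inE ww1.
    by rewrite eW inE => /eqP ->.
  exfalso.
  (* A third branch contributes another factor 2, so the same addition gives 2(1 + A^2) <= 3A, which
     has no real solution. *)
  have h2 : (1 + A%:R ^+ 2) * 2 <= \prod_(v in W :\ w1) (P v).+1%:R :> rat.
    rewrite (big_setD1 w2) //=; apply: ler_pM.
    - by rewrite addr_ge0 ?ler01 ?exprn_ge0 ?ler0n.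
    - by [].
    - by rewrite -natr1; lra.
    apply: le_trans (_ : 2 ^+ #|W :\ w1 :\ w2| <= _).
      by rewrite -{1}[2]expr1 ler_eXn2l // ltr1n.
    by apply: exp2_le_prod_succ => j /setD1P[_ /setD1P[_ jW]]; apply: P0.
  have x0 : 0 <= g w1 by lra.
  have h3 := le_trans (ler_wpM2l x0 h2) key2.
  have G0 : 0 <= G by apply: le_trans Gh; rewrite divr_ge0.
  have h4 : (1 + A%:R ^+ 2) * G <= A%:R * (g w1 + G).
    by apply: le_trans key1; apply: ler_wpM2r => //; lra.
  have s0 : 0 < g w1 + G by lra.
  have : (2 * (1 + A%:R ^+ 2) - 3 * A%:R) * (g w1 + G) <= 0 by lra.
  by rewrite pmulr_lle0 //; nra.
(* Now [a w2 < a w1]. If G >= 1, [key1] bounds x from below while [ag1] bounds it from above. *)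
exfalso; set A := a w1 in aP1 ag1 a0' lA *; set p := P w1 in aP1 ag1 key1 *.
have aP1' : A%:R ^+ 2 <= p%:R :> rat by rewrite -natrX ler_nat.
have lA' : (a w2)%:R + 1 <= A%:R :> rat by rewrite natr1 ler_nat.
have b1 : 1 <= (a w2)%:R :> rat by rewrite ler1n a0.
rewrite -addn1 natrD in key1 ag1.
set b := (a w2)%:R in key1 lA' b1; set x := g w1 in key1 ag1 gh1 M0.
set c := A%:R in aP1' lA' ag1; set q := p%:R in key1 aP1' ag1.
have [G1|G1] := lerP 1 G.
  have qb : 0 <= q + 1 - b by nra.
  have h1 : q + 1 - b <= b * x by nra.
  have h2 : c * (q + 1) * (q + 1 - b) <= b * q ^+ 2.
    have : c * (q + 1) * (q + 1 - b) <= c * (q + 1) * (b * x).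
      by apply: ler_wpM2l => //; nra.
    have : b * (c * (q + 1) * x) <= b * q ^+ 2 by apply: ler_wpM2l => //; lra.
    lra.
  have h3 : c * (q + 1) * (q + 2 - c) <= c * (q + 1) * (q + 1 - b).
    by apply: ler_wpM2l; [nra|lra].
  have h4 : b * q ^+ 2 <= (c - 1) * q ^+ 2.
    by apply: ler_wpM2r; [apply: sqr_ge0|lra].
  have q0 : 0 <= q by rewrite ler0n.
  have h5 : 0 <= q * (q - c ^+ 2) by apply: mulr_ge0; lra.
  have h6 : 0 <= (c - 1) * q by apply: mulr_ge0; lra.
  (* Expanding [h2], [h3], [h4] leaves q(q - c^2) + 3cq + 2c - c^2 <= 0, impossible for q >= c^2 and
     c >= 1. *)
  suff : 0 < 0 :> rat by rewrite ltxx.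
  lra.
(* If G < 1, the lower bounds on [g] leave only w2 besides w1, with [P w2 = 1] and b = 1. Then q / 2
   <= x, and [ag1] gives c(q + 1) <= 2q, against c >= 2. *)
have n0 : #|W :\ w1 :\ w2| = 0%N.
  apply/eqP; rewrite -leqn0 leqNgt; apply/negP => n0.
  have c2 : 2 <= #|W :\ w1|%:R :> rat by rewrite ler_nat cW2.
  by move: Gh G1 c2; clear; lra.
have eW : W :\ w1 = [set w2].
  by apply/esym/eqP; rewrite eqEcard sub1set w2W' cards1 cW2 n0.
have eG : G = g w2 by rewrite /G eW big_set1.
have P2 : (P w2 <= 1)%N.
  by rewrite leqNgt; apply/negP => /(g1 w2 w2W); rewrite -eG; lra.
have eb : a w2 = 1%N by have := a0 w2 w2W; case: (a w2) aP2 => [|[|c']] // /leq_trans/(_ P2).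
have gh2 := gh w2 w2W; rewrite -eG in gh2.
have eb' : b = 1 by rewrite /b eb.
rewrite {}eb' in key1 lA' b1.
have h1 : q / 2 <= x by nra.
have h2 : c * (q + 1) * (q / 2) <= c * (q + 1) * x by apply: ler_wpM2l => //; nra.
have q0 : 0 < q by rewrite ltr0n P0.
have h3 : 0 <= (c - 2) * (q * (q + 1)) by apply: mulr_ge0; [lra|apply: mulr_ge0; lra].
suff : 0 < 0 :> rat by rewrite ltxx.
lra.
Qed.

(** * Means of products and bounds for one branch *)

Lemma mean_mul (p q : {poly rat}) :
  p.[1] != 0 -> q.[1] != 0 -> mean (p * q) = mean p + mean q.
Proof.
move=> p0 q0; rewrite /mean derivM hornerD !hornerM.
by field; apply/andP.
Qed.

Lemma mean_prod (I : finType) (A : {set I}) (F : I -> {poly rat}) :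
  (forall i, i \in A -> (F i).[1] != 0) ->
  mean (\prod_(i in A) F i) = \sum_(i in A) mean (F i).
Proof.
move=> h; suff [] : (\prod_(i in A) F i).[1] != 0 /\
    mean (\prod_(i in A) F i) = \sum_(i in A) mean (F i) by [].
apply: (big_rec2 (fun (p : {poly rat}) s => p.[1] != 0 /\ mean p = s)).
  by rewrite /mean derivE hornerC hornerC mul0r oner_eq0.
move=> i p s iA [p0 <-]; rewrite hornerM mean_mul ?h //.
by rewrite mulf_neq0 ?h.
Qed.

Lemma gfam1_neq0 (V : finType) (P : pred {set V}) :
  P set0 -> (gfam P).[1] != 0.
Proof. by move=> P0; rewrite gfam1 pnatr_eq0 -lt0n; apply/card_gt0P; exists set0. Qed.

Lemma mean_gfam_mul (V : finType) (P : pred {set V}) :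
  P set0 -> #|P|%:R * mean (gfam P) = (\sum_(Y : {set V} | P Y) #|Y|)%:R.
Proof.
move=> P0; have := gfam1_neq0 P0; rewrite /mean gfam_deriv1 gfam1 => n0.
by rewrite mulrC mulfVK // natr_sum.
Qed.

Lemma mean_gfam_lower (V : finType) (P : pred {set V}) :
  P set0 -> #|P|%:R - 1 <= #|P|%:R * mean (gfam P).
Proof.
move=> P0; rewrite mean_gfam_mul // lerBlDr natr1 ler_nat -sum1_card.
rewrite [in leqLHS](bigD1 set0) // [in leqRHS](bigD1 set0) //= cards0 add0n add1n ltnS.
by apply: leq_sum => Y /andP[_]; rewrite -card_gt0.
Qed.

(** Deleting elements one at a time gives a member of every smaller size, so each Y has at least
    [#|Y|] strictly smaller members. The sum of sizes is thus at most the number of pairs of members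
    with different sizes. *)
Lemma sum_card_accessible (V : finType) (P : pred {set V}) :
  (forall Y, P Y -> Y != set0 -> exists2 x, x \in Y & P (Y :\ x)) ->
  ((\sum_(Y : {set V} | P Y) #|Y|).*2 <= #|P| * (#|P|).-1)%N.
Proof.
move=> acc.
have small (Y : {set V}) : P Y -> (#|Y| <= \sum_(Z : {set V} | P Z) (#|Z| < #|Y|))%N.
  have [n] := ubnP #|Y|; elim: n Y => // n IH Y lY PY.
  have [->|Y0] := eqVneq Y set0; first by rewrite cards0.
  have [x xY PYx] := acc Y PY Y0.
  have cY : #|Y| = #|Y :\ x|.+1 by rewrite (cardsD1 x) xY.
  have lx : (#|Y :\ x| < n)%N by rewrite cY in lY.
  rewrite {1}cY; apply: leq_ltn_trans (IH _ lx PYx) _.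
  rewrite [ltnLHS](bigD1 (Y :\ x)) // [ltnRHS](bigD1 (Y :\ x)) //= ltnn cY ltnSn.
  rewrite add0n add1n ltnS; apply: leq_sum => Z _.
  by case: (ltnP #|Z| #|Y :\ x|) => // lt; rewrite (leqW lt).
have hs : (\sum_(Y : {set V} | P Y) #|Y| <=
    \sum_(Y : {set V} | P Y) \sum_(Z : {set V} | P Z) (#|Z| < #|Y|))%N.
  exact: leq_sum.
rewrite -addnn; apply: leq_trans (leq_add hs hs) _.
(* With one copy transposed, an ordered pair of distinct members counts at most once. *)
rewrite [X in (_ + X <= _)%N]exchange_big /= -big_split /=.
rewrite -sum_nat_const; apply: leq_sum => Y PY.
rewrite -big_split /= (bigD1 Y) //= !ltnn add0n.
have PY' : Y \in P by []; rewrite (cardD1 Y) PY' /=; apply: leq_trans (_ : \sum_(Z | P Z && (Z != Y)) 1 <= _)%N.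
  by apply: leq_sum => Z _; case: (ltngtP #|Z| #|Y|).
by rewrite ?add0n sum1_card; apply: eq_leq; apply: eq_card => Z; rewrite !inE andbC.
Qed.

Lemma mean_gfam_upper (V : finType) (P : pred {set V}) :
  P set0 ->
  (forall Y, P Y -> Y != set0 -> exists2 x, x \in Y & P (Y :\ x)) ->
  mean (gfam P) <= (#|P|%:R - 1) / 2.
Proof.
move=> P0 acc; have n0 : (0 < #|P|)%N by apply/card_gt0P; exists set0.
have n0' : 0 < #|P|%:R :> rat by rewrite ltr0n.
rewrite -(ler_pM2l n0') mean_gfam_mul //.
have := sum_card_accessible acc; rewrite -(ler_nat rat) -mul2n !natrM.
by rewrite -subn1 natrB // => h; lra.
Qed.

Lemma mean_gfam_ge0 (V : finType) (P : pred {set V}) : 0 <= mean (gfam P).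
Proof. by rewrite /mean gfam_deriv1 gfam1 -natr_sum divr_ge0 ?ler0n. Qed.

Lemma side_family0 (V : finType) (B : {set V}) (K : V -> {set V}) u :
  side_family B K u set0.
Proof. by rewrite /side_family /= closed_over0 inE. Qed.

(** A vertex of maximal rank in Y is a parent of no other vertex of Y. *)
Lemma side_family_accessible (V : finType) k (B : {set V}) E K r u (Y : {set V}) :
  rooting k setT B E K r -> u \in B -> side_family B K u Y -> Y != set0 ->
  exists2 x, x \in Y & side_family B K u (Y :\ x).
Proof.
rewrite /side_family /= => hr uB /andP[/closed_overP[d cl] uY] /set0Pn[y yY].
have [x xY xmax] := @arg_maxnP _ y (mem Y) r yY; exists x => //.
rewrite !inE (negbTE uY) andbF andbT; apply/closed_overP; split.
  by apply: disjointWl d; apply: subsetDl.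
have out v : v \in Y -> v \notin B.
  move=> vY; have := disjointFr d vY; rewrite !inE; case: (boolP (v == u)) => [/eqP ev|_ /negbT//].
  by rewrite -ev vY in uY.
move=> v w; rewrite inE => /andP[_ vY] wK wB; have wY := cl v w vY wK wB.
rewrite !inE wY andbT; apply: contraTneq (xmax v vY) => <-.
by rewrite -ltnNge (rooting_rank hr (in_setT v) (out v vY) wK (out w wY)).
Qed.

(** Iterates (a - 1) + (b - 1) <= ab - 1 for a, b >= 1. *)
Lemma sum_half_pred_le (I : finType) (A : {set I}) (n : I -> nat) (m : I -> rat) :
  (forall i, i \in A -> (0 < n i)%N) ->
  (forall i, i \in A -> m i <= ((n i)%:R - 1) / 2) ->
  (0 < \prod_(i in A) n i)%N /\
  \sum_(i in A) m i <= ((\prod_(i in A) n i)%:R - 1) / 2.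
Proof.
move=> n0 hm; apply: (big_rec2 (fun (q : nat) s => (0 < q)%N /\ s <= (q%:R - 1) / 2)).
  by rewrite subrr mul0r.
move=> i q s iA [q0 hs]; split; first by rewrite muln_gt0 n0.
have h1 : 1 <= (n i)%:R :> rat by rewrite ler1n n0.
have h2 : 1 <= q%:R :> rat by rewrite ler1n.
rewrite natrM; have := hm i iA; have : 0 <= ((n i)%:R - 1) * (q%:R - 1) :> rat.
  by apply: mulr_ge0; rewrite subr_ge0.
lra.
Qed.

(** Take u with [n u] least and let Q be the product of the other factors. As there is at least one
    other, [n u <= Q]; the bounds on [m] then give 1 + S <= Q, where S is the sum of the means. *)
Lemma branch_bounds (I : finType) (A : {set I}) (n : I -> nat) (m : I -> rat)
    (P : nat) (g : rat) :
  (1 < #|A|)%N ->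
  (forall i, i \in A -> (0 < n i)%N) ->
  (forall i, i \in A -> 0 <= m i) ->
  (forall i, i \in A -> (n i)%:R - 1 <= (n i)%:R * m i) ->
  (forall i, i \in A -> m i <= ((n i)%:R - 1) / 2) ->
  P = (\prod_(i in A) n i)%N ->
  g * P.+1%:R = P%:R * (1 + \sum_(i in A) m i) ->
  exists2 u, u \in A &
    [/\ (n u ^ 2 <= P)%N, (n u)%:R * P.+1%:R * g <= P%:R ^+ 2, 1 / 2 <= g
      & (1 < P)%N -> 1 <= g].
Proof.
move=> A2 n0 m0 ml mu eP eg; set S := \sum_(i in A) m i in eg.
have /card_gt0P[i0 i0A] : (0 < #|A|)%N by rewrite ltnW.
have [u uA umin] := @arg_minnP _ i0 (mem A) n i0A; rewrite /= in uA umin.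
exists u => //; pose Q := (\prod_(i in A :\ u) n i)%N.
have ePQ : P = (n u * Q)%N by rewrite eP (big_setD1 u).
have n0' i : i \in A :\ u -> (0 < n i)%N by move=> /setD1P[_]; apply: n0.
have m0' i : i \in A :\ u -> m i <= ((n i)%:R - 1) / 2 by move=> /setD1P[_]; apply: mu.
have [Q0 hQ] := sum_half_pred_le n0' m0'; rewrite -/Q in Q0 hQ.
have uQ : (n u <= Q)%N.
  have /card_gt0P[v vA] : (0 < #|A :\ u|)%N by move: A2; rewrite (cardsD1 u) uA.
  have /setD1P[_ vA'] := vA; rewrite /Q (big_setD1 v) //=.
  apply: leq_trans (umin v vA') _; apply: leq_pmulr.
  by apply: prodn_cond_gt0 => i /setD1P[_]; apply: n0'.
have P0 : (0 < P)%N by rewrite ePQ muln_gt0 n0.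
have S0 : 0 <= S by apply: sumr_ge0.
have P1 : 1 <= P%:R :> rat by rewrite ler1n.
have Pp : 0 < P.+1%:R :> rat by rewrite ltr0n.
split.
- by rewrite ePQ expnS expn1 leq_mul2l uQ orbT.
- rewrite -mulrA [_ * g]mulrC eg.
  have SQ : 1 + S <= Q%:R.
    rewrite /S (big_setD1 u) //=; have := mu u uA.
    have : (n u)%:R <= Q%:R :> rat by rewrite ler_nat.
    lra.
  rewrite expr2 {3}ePQ natrM mulrCA; apply: ler_wpM2l; first by rewrite ler0n.
  by apply: ler_wpM2l => //; rewrite ler0n.
- rewrite -(ler_pM2r Pp) eg -[P.+1%:R]natr1.
  have PS : 0 <= P%:R * S by apply: mulr_ge0 => //; lra.
  lra.
move=> P2; rewrite -(ler_pM2r Pp) eg mul1r -[P.+1%:R]natr1.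
have P2' : 2 <= P%:R :> rat by rewrite ler_nat.
(* If P > 1, some [n v] is at least 2, and the lower bound on [m v] makes it at least 1/2. *)
suff : 1 / 2 <= S by nra.
have [v vA v1] : exists2 v, v \in A & (1 < n v)%N.
  have /existsP[v /andP[vA v1]] : [exists v, (v \in A) && (1 < n v)%N].
    apply: contraLR P2 => /existsPn h; rewrite -leqNgt eP big1 // => i iA.
    by have := h i; rewrite iA /= -leqNgt => h1; apply/eqP; rewrite eqn_leq h1 n0.
  by exists v.
rewrite /S (big_setD1 v) //=.
have rest : 0 <= \sum_(i in A :\ v) m i by apply: sumr_ge0 => i /setD1P[_]; apply: m0.
have v1' : 2 <= (n v)%:R :> rat by rewrite ler_nat.
have := ml v vA; have := m0 v vA; nra.
Qed.

(** * Comparison of C with the other k-cliques of its bags *)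

Lemma horner1_1DXM (p : {poly rat}) : (1 + 'X * p).[1] = 1 + p.[1].
Proof. by rewrite hornerD hornerM hornerX hornerC mul1r. Qed.

Lemma mean_1DXM (p : {poly rat}) : 0 < p.[1] ->
  mean (1 + 'X * p) * (1 + p.[1]) = p.[1] * (1 + mean p).
Proof.
move=> p0; rewrite /mean horner1_1DXM derivD derivM derivX derivE mul1r add0r.
rewrite hornerD hornerM hornerX mul1r.
by field; apply/andP; split; rewrite gt_eqF // addr_gt0.
Qed.

(** Clearing the denominator and substituting M cancels all terms in h p, leaving s times [mean s]
    plus g h <= s M (values at 1); the first term is nonnegative. *)
Lemma mean_split_le (s h p : {poly rat}) (g M : rat) :
  0 < s.[1] -> 0 < h.[1] -> 0 < p.[1] -> 0 <= mean s ->
  g * (1 + p.[1]) = p.[1] * (1 + mean p) -> M = mean h + g ->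
  mean (s + 'X * (h * p)) <= M -> g * h.[1] <= s.[1] * M.
Proof.
move=> s0 h0 p0 ms eg eM.
have e q : q.[1] != 0 -> q^`().[1] = q.[1] * mean q :> rat.
  by move=> q0; rewrite /mean mulrC mulfVK.
have hp0 : 0 < h.[1] * p.[1] by apply: mulr_gt0.
rewrite {1}/mean derivD derivM derivX !(mul1r, hornerD, hornerM, hornerX).
rewrite (e (h * p)) ?hornerM ?gt_eqF // (e s) ?gt_eqF // mean_mul ?gt_eqF //.
rewrite ler_pdivrMr ?addr_gt0 // => le.
have eg' : h.[1] * (g * (1 + p.[1])) = h.[1] * (p.[1] * (1 + mean p)) by rewrite eg.
have := mulr_ge0 (ltW s0) ms; rewrite eM in le *.
lra.
Qed.

Lemma closed_over_child (V : finType) (C : {set V}) (K : V -> {set V}) w :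
  w \notin C -> K w = C ->
  gfam (closed_over C K) = gfam (side_family (w |: C) K w) +
    'X * gfam (closed_over (w |: C) K).
Proof.
move=> wC Kw; rewrite -clique_split ?setU11 // setU1K //.
by congr (gfam (closed_over C _)); apply/funext => v; case: eqP => // ->.
Qed.

(** Splitting at w and factoring the bag gives f h = h + X h times the product over C; the nonzero
    factor h cancels. *)
Lemma branch_poly (V : finType) k (C : {set V}) E K r w (f h : {poly rat}) :
  rooting k setT C E K r -> #|C| = k -> w \notin C -> K w = C ->
  gfam (closed_over C K) = f * h ->
  h = gfam (side_family (w |: C) K w) ->
  f = 1 + 'X * \prod_(u in C) gfam (side_family (w |: C) K u).
Proof.
move=> hr cC wC Kw ef eh.
have cB : #|w |: C| = k.+1 by rewrite cardsU1 wC cC.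
have hB := rooting_grow hr (in_setT w) wC Kw.
have h0 : h != 0.
  by apply: contraTneq (gfam1_neq0 (side_family0 (w |: C) K w)) => e; rewrite -eh e horner0 eqxx.
apply: (mulIf h0); rewrite -ef (closed_over_child wC Kw) (bag_factor cB hB).
by rewrite big_setU1 //= -eh; ring.
Qed.

Lemma two_children (V : finType) k (C : {set V}) E K r (W : {set V}) :
  (1 < k)%N -> rooting k setT C E K r -> #|C| = k ->
  (forall C', kclique k setT E C' -> mu k setT E C' <= mu k setT E C) ->
  W = [set w | (w \notin C) && (K w == C)] -> (1 < #|W|)%N ->
  #|W| = 2%N /\ #|closed_over C K| = 4%N.
Proof.
move=> k2 hr cC cmax eW W2.
have [P [eF eH P0]] := branch_factor hr cC eW.
have hW w : w \in W -> w \notin C /\ K w = C.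
  by rewrite eW inE => /andP[wC /eqP].
pose s w u := gfam (side_family (w |: C) K u).
pose n w u := #|side_family (w |: C) K u|.
pose p w := \prod_(u in C) s w u.
pose N w := (\prod_(u in C) n w u)%N.
pose g w := mean (gfam (P w)).
have s1 w u : (s w u).[1] = (n w u)%:R by rewrite gfam1.
have n0 w u : (0 < n w u)%N.
  by apply/card_gt0P; exists set0; apply: side_family0.
have s0 w u : (s w u).[1] != 0 by rewrite s1 pnatr_eq0 -lt0n.
have p1 w : (p w).[1] = (N w)%:R.
  by rewrite /p horner_prod natr_prod; apply: eq_bigr => u _; rewrite s1.
have N0 w : (0 < N w)%N by apply: prodn_gt0.
have p0 w : 0 < (p w).[1] by rewrite p1 ltr0n.
have mp w : mean (p w) = \sum_(u in C) mean (s w u) by apply: mean_prod.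
have ef w : w \in W -> gfam (P w) = 1 + 'X * p w.
  move=> wW; have [wC Kw] := hW w wW.
  apply: branch_poly hr cC wC Kw _ (esym (eH w wW)).
  by rewrite eF (big_setD1 w).
have f1 w : w \in W -> (gfam (P w)).[1] = (N w).+1%:R.
  by move=> wW; rewrite ef // horner1_1DXM p1 nat1r.
have eg w : w \in W -> g w * (1 + (p w).[1]) = (p w).[1] * (1 + mean (p w)).
  by move=> wW; rewrite /g ef // mean_1DXM.
have f0 w : w \in W -> (gfam (P w)).[1] != 0 by move=> wW; apply/gfam1_neq0/P0.
pose M := \sum_(w in W) g w.
have eM : mean (gfam (closed_over C K)) = M by rewrite eF mean_prod.
(* The membership of w sits inside the existential so that [choice] yields a function [c] on all of
   V. *)
have bounds w : exists u, w \in W -> u \in C /\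
    [/\ (n w u ^ 2 <= N w)%N, (n w u)%:R * (N w).+1%:R * g w <= (N w)%:R ^+ 2,
      1 / 2 <= g w & (1 < N w)%N -> 1 <= g w].
  case: (boolP (w \in W)) => [wW|_]; last by exists w.
  have [wC Kw] := hW w wW; have hB := rooting_grow hr (in_setT w) wC Kw.
  have [|||||||u uC h] := @branch_bounds _ C (n w) (fun u => mean (s w u)) (N w) (g w).
  - by rewrite cC.
  - by [].
  - by move=> u _; apply: mean_gfam_ge0.
  - by move=> u _; apply: mean_gfam_lower; apply: side_family0.
  - move=> u uC; apply: mean_gfam_upper; first exact: side_family0.
    by move=> Y; apply: side_family_accessible hB _; rewrite inE uC orbT.
  - by [].
  - by have := eg w wW; rewrite p1 mp nat1r.
  by exists u.
have {bounds} [c hc] := choice bounds.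
(* Maximality of C is tested against the bag of w minus [c w], the bag vertex with the smallest side
   family found above. *)
have key w : w \in W -> g w * \prod_(v in W :\ w) (N v).+1%:R <= (n w (c w))%:R * M.
  move=> wW; have [uC _] := hc w wW; have [wC Kw] := hW w wW.
  have hB := rooting_grow hr (in_setT w) wC Kw.
  have cB : #|w |: C| = k.+1 by rewrite cardsU1 wC cC.
  have uB : c w \in w |: C by rewrite inE uC orbT.
  have hU := rooting_drop hB cB uB.
  have cU : #|(w |: C) :\ c w| = k by move: cB; rewrite (cardsD1 (c w)) uB => -[].
  have := cmax ((w |: C) :\ c w); rewrite /kclique subsetT cU eqxx.
  move=> /(_ (rooting_root_clique hU)).
  rewrite (mu_mean cU hU) (mu_mean cC hr) lerD2l eM clique_split // (bag_factor cB hB).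
  rewrite big_setU1 //= => le.
  have e1 : (s w w).[1] = \prod_(v in W :\ w) (N v).+1%:R.
    rewrite /s eH // horner_prod; apply: eq_bigr => v /setD1P[_ vW]; exact: f1.
  rewrite -e1 -s1; apply: (mean_split_le (p := p w)) le => //.
  - by rewrite s1 ltr0n.
  - by rewrite s1 ltr0n.
  - exact: mean_gfam_ge0.
  - exact: eg.
  rewrite /s eH // mean_prod; last by move=> v /setD1P[_ vW]; apply: f0.
  by rewrite /M (big_setD1 w) //= addrC.
have [cW N1] : #|W| = 2%N /\ forall w, w \in W -> N w = 1%N.
  apply: (two_trivial_branches (a := fun w => n w (c w)) (g := g)) => // w wW;
    by have [_ []] := hc w wW.
split=> //; apply/eqP; rewrite -(eqr_nat rat) -gfam1 eF horner_prod.
rewrite (eq_bigr (fun=> 2)) => [|w wW]; last by rewrite f1 // N1.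
by rewrite prodr_const cW.
Qed.

(** * Complements of size two, degrees and the conclusion *)

Lemma card_complement_two (V : finType) (C : {set V}) (K : V -> {set V}) (W : {set V}) :
  W \subset ~: C ->
  (forall w, w \in W -> K w = C) -> #|W| = 2%N -> #|closed_over C K| = 4%N ->
  #|~: C| = 2%N.
Proof.
move=> sW KW cW c4; apply/eqP; rewrite eqn_leq -{2}cW subset_leq_card // andbT leqNgt.
apply/negP => C3.
have clW (Y : {set V}) : Y \subset W -> closed_over C K Y.
  move=> sY; apply/closed_overP; split; first by rewrite disjoints_subset (subset_trans sY).
  by move=> v x vY; rewrite KW ?(subsetP sY) // => ->.
have clT : closed_over C K (~: C).
  by apply/closed_overP; split=> [|v x _ _]; rewrite ?disjoints_subset ?inE.
(* The four subsets of W are closed; a larger complement of C would be a fifth closed set. *)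
have : (#|[predU1 ~: C & powerset W]| <= #|closed_over C K|)%N.
  apply: subset_leq_card; apply/subsetP => Y; rewrite !inE => /orP[/eqP -> //|].
  exact: clW.
rewrite cardU1 card_powerset cW c4 inE.
have [/subset_leq_card|//] := boolP (~: C \subset W).
by rewrite cW leqNgt C3.
Qed.

Lemma clique_degree_children (V : finType) k (C : {set V}) E K r :
  rooting k setT C E K r -> #|C| = k ->
  clique_degree k E C = #|[set w | (w \notin C) && (K w == C)]|.
Proof.
move=> hr cC; rewrite /clique_degree.
have -> : [set D : {set V} | [&& C \subset D, #|D| == k.+1 & isclique E D]] =
    [set w |: C | w in [set w | (w \notin C) && (K w == C)]].
  apply/setP => D; rewrite inE; apply/and3P/imsetP => [[sC /eqP cD cl]|[w]].
    have /cards1P[w ew] : #|D :\: C| == 1%N by rewrite cardsD (setIidPr sC) cD cC subSnn.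
    have /setDP[wD wC] : w \in D :\: C by rewrite ew set11.
    have eD : D = w |: C.
      rewrite -ew setUC; apply/setP => x; rewrite !inE.
      by case: (boolP (x \in C)) => // /(subsetP sC) ->.
    exists w => //; rewrite inE wC /=.
    by rewrite -(rooting_parent_clique hr cC (in_setT w) wC) -eD.
  rewrite inE => /andP[wC Kw] ->; split; first exact: subsetUr.
    by rewrite cardsU1 wC cC.
  by rewrite (rooting_parent_clique hr cC (in_setT w) wC).
rewrite card_in_imset // => w v; rewrite !inE => /andP[wC _] /andP[vC _] e.
have : w \in v |: C by rewrite -e setU11.
by rewrite !inE (negbTE wC) orbF => /eqP.
Qed.

(** Summing size minus 1 over the closed sets, the empty set gives -1, the full complement gives 1,
    and any singleton gives 0. *)
Lemma mean_two_vertices (V : finType) (C : {set V}) (K : V -> {set V}) :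
  #|~: C| = 2%N -> mean (gfam (closed_over C K)) = 1.
Proof.
move=> c2; have clT : closed_over C K (~: C).
  by apply/closed_overP; split=> [|v x _ _]; rewrite ?disjoints_subset ?inE.
have cl0 := closed_over0 C K.
have n0 := gfam1_neq0 cl0; apply: (mulIf n0); rewrite /mean mulfVK // mul1r.
apply/eqP; rewrite -subr_eq0 gfam_deriv1 gfam1 -sum1_card natr_sum -sumrB.
have ne : ~: C != set0 by rewrite -card_gt0 c2.
rewrite (bigD1 set0) //= (bigD1 (~: C)) /=; last by rewrite clT.
rewrite big1 => [|Y /andP[/andP[/closed_overP[d _] Y0] YC]].
  by rewrite cards0 c2 addr0.
have : Y \proper ~: C by rewrite properEneq YC -disjoints_subset.
move/proper_card; rewrite c2 ltnS => Y1.
have -> : #|Y| = 1%N by apply/eqP; rewrite eqn_leq Y1 card_gt0.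
by rewrite subrr.
Qed.

Local Close Scope ring_scope.

Theorem theorem1p3 (k : nat) (V : finType) (E : {set {set V}}) :
  2 <= k ->
  ktree k [set: V] E ->
  k.+1 <= #|V| ->
  (#|V| <> k.+2 ->
     forall C : {set V}, kclique k [set: V] E C ->
     (forall C' : {set V}, kclique k [set: V] E C' ->
        (mu k [set: V] E C' <= mu k [set: V] E C)%R) ->
     clique_degree k E C = 1)
  /\
  (#|V| = k.+2 ->
     forall C : {set V}, kclique k [set: V] E C ->
     mu k [set: V] E C = (k.+1)%:R%R).
Proof.
move=> k2 kt Vk; have cardC (C : {set V}) : #|C| = k -> #|~: C| = #|V| - k.
  by move=> <-; rewrite -(cardsC C) addKn.
split=> [nV C clC cmax|nV C clC]; have /and3P[_ /eqP cC _] := clC;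
  have [K [r hr]] := rooting_exists kt clC; last first.
  rewrite (mu_mean cC hr) mean_two_vertices ?natr1 // cardC // nV.
  by rewrite subSn ?leqnSn // subSnn.
rewrite (clique_degree_children hr cC).
set W := [set w | _]; apply/eqP; rewrite eqn_leq; apply/andP; split.
  rewrite leqNgt; apply/negP => W2; case: nV.
  have [cW c4] := two_children k2 hr cC cmax erefl W2.
  have c2 : #|~: C| = 2.
    apply: card_complement_two cW c4.
      by apply/subsetP => w; rewrite !inE => /andP[].
    by move=> w; rewrite inE => /andP[_ /eqP].
  by rewrite -(cardsC C) cC c2 addn2.
(* Since n > k there is a vertex outside C, and the branch containing it starts at a child of C. *)
have /card_gt0P[x xC] : 0 < #|~: C| by rewrite cardC // subn_gt0.
have [b [hb _ _]] := child_labels hr cC.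
rewrite inE in xC; have [bC Kb] := hb x xC.
by apply/card_gt0P; exists (b x); rewrite inE bC Kb eqxx.
Qed.
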